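(* $k_n\ge \dfrac{2\log_2 n}{\log_2 14.864}+O(1)$, i.e. $k_n\ge 0.51364\log_2 n+O(1)$.
   Context: A system of $k$ stacks in series consists of an input queue, stacks $1,\dots,k$, and an output queue. Moves $m_1,\dots,m_{k+1}$: $m_1$ moves the front of the input queue onto stack 1; $m_i$ ($2\le i\le k$) pops stack $i-1$ and pushes onto stack $i$; $m_{k+1}$ pops stack $k$ and enqueues at the back of the output queue; a move is illegal if its source is empty. A permutation $\pi\in S_n$ is generated by $k$ stacks if some legal sequence of moves, starting with $1,\dots,n$ (front to back) in the input queue and everything else empty, ends with $\pi(1),\dots,\pi(n)$ (front to back) in the output queue and everything else empty. $P_n^k$ is the set of such $\pi$, and $k_n$ is the smallest $k$ with $P_n^k=S_n$ (the number of stacks in series needed to sort any permutation of $n$ elements). *)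

(* Defs.v *)
From Stdlib Require Import Bool Reals List Permutation Arith.
Import ListNotations.
Open Scope R_scope.

(* Configuration of a system of k stacks in series:
   (input queue, stacks 1..k, output queue).
   Queues are listed front to back; each stack is listed top first.
   The list of stacks has length k; stack i (1-based) is at position i-1. *)
Record config := Config {
  cin : list nat;
  cstacks : list (list nat);
  cout : list nat }.

Fixpoint replace_nth {A : Type} (l : list A) (j : nat) (x : A) : list A :=
  match l, j with
  | [], _ => []
  | _ :: t, O => x :: t
  | h :: t, S j' => h :: replace_nth t j' x
  end.

Definition move (k i : nat) (c : config) : option config :=
  if Nat.eqb i 1 then
    match cin c with
    | [] => None
    | x :: r =>
        if Nat.leb 1 k then
          Some (Config r (replace_nth (cstacks c) 0 (x :: nth 0 (cstacks c) [])) (cout c))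
        else (* k = 0: stack 1 does not exist; m_1 = m_{k+1} moves input to output *)
          Some (Config r (cstacks c) (cout c ++ [x]))
    end
  else if Nat.leb 2 i && Nat.leb i k then
    match nth (i - 2) (cstacks c) [] with
    | [] => None
    | x :: r =>
        Some (Config (cin c)
                (replace_nth (replace_nth (cstacks c) (i - 2) r) (i - 1)
                   (x :: nth (i - 1) (cstacks c) []))
                (cout c))
    end
  else if Nat.eqb i (k + 1) && Nat.leb 2 i then
    match nth (k - 1) (cstacks c) [] with
    | [] => None
    | x :: r =>
        Some (Config (cin c) (replace_nth (cstacks c) (k - 1) r) (cout c ++ [x]))
    end
  else None.

Fixpoint run (k : nat) (ms : list nat) (c : config) : option config :=
  match ms with
  | [] => Some c
  | i :: ms' =>
      match move k i c with
      | None => None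
      | Some c' => run k ms' c'
      end
  end.

(* pi (given as the list pi(1),...,pi(n)) is generated by k stacks. *)
Definition generated_by (k n : nat) (pi : list nat) : Prop :=
  exists ms : list nat,
    run k ms (Config (seq 1 n) (repeat [] k) []) = Some (Config [] (repeat [] k) pi).

Definition all_generated (k n : nat) : Prop :=
  forall pi : list nat, Permutation pi (seq 1 n) -> generated_by k n pi.

Definition is_k_n (n k : nat) : Prop :=
  all_generated k n /\ forall k', all_generated k' n -> (k <= k')%nat.

Definition log2R (x : R) : R := ln x / ln 2.

(* Main.v *)
(** Group the stacks in consecutive pairs: what a pair does to the sequence
    passing through it is determined by a word over the three moves [A], [B],
    [C] (input to first stack, first to second stack, second stack to output).
    The words [AC] and [CA] have the same effect in every state, and so do
    [BABC] and [ABCB], and [ABBC] and [BCAB].  Rewriting towards the second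
    member of each pair brings some [C] forward, so it terminates, and only
    words avoiding [AC], [BABC] and [ABBC] matter.  A weighted count shows that
    there are at most [14 ^ (n + 1)] of these with [n] letters of each kind.
    Hence [n! <= 14 ^ ((n + 1) * ceil (k / 2))], and [14 < 14.864]. *)
Require Import Defs.
From Stdlib Require Import Reals List Permutation Arith.
From Stdlib Require Import Lra Lia.
Import ListNotations.
Open Scope R_scope.

Local Open Scope nat_scope.

(** * Words of moves through two stacks *)

Inductive letter := A | B | C.

Definition letter_eq_dec (x y : letter) : {x = y} + {x <> y}.
Proof. decide equality. Defined.

Notation count l w := (count_occ letter_eq_dec w l).

(* [exec w i s1 s2 q]: from input [i] and stacks [s1], [s2], the word [w] empties
   the input and both stacks and emits [q]. *)
Inductive exec {X : Type} :
  list letter -> list X -> list X -> list X -> list X -> Prop :=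
| exec_nil : exec [] [] [] [] []
| exec_A w x i s1 s2 q : exec w i (x :: s1) s2 q -> exec (A :: w) (x :: i) s1 s2 q
| exec_B w x i s1 s2 q : exec w i s1 (x :: s2) q -> exec (B :: w) i (x :: s1) s2 q
| exec_C w x i s1 s2 q : exec w i s1 s2 q -> exec (C :: w) i s1 (x :: s2) (x :: q).

Lemma exec_functional {X : Type} w (i s1 s2 q q' : list X) :
  exec w i s1 s2 q -> exec w i s1 s2 q' -> q = q'.
Proof.
  intros H; revert q'; induction H; intros q' H'; inversion H'; subst; auto.
  f_equal; auto.
Qed.

Lemma exec_count {X : Type} w (i s1 s2 q : list X) :
  exec w i s1 s2 q ->
  count A w = length i /\
  count B w = length i + length s1 /\
  count C w = length i + length s1 + length s2 /\
  length q = length i + length s1 + length s2.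
Proof. induction 1; simpl in *; lia. Qed.

Lemma length_count w : length w = count A w + count B w + count C w.
Proof. induction w as [|[] w IH]; simpl; lia. Qed.

Inductive step : list letter -> list letter -> Prop :=
| step_AC w : step (A :: C :: w) (C :: A :: w)
| step_BABC w : step (B :: A :: B :: C :: w) (A :: B :: C :: B :: w)
| step_ABBC w : step (A :: B :: B :: C :: w) (B :: C :: A :: B :: w)
| step_cons l w w' : step w w' -> step (l :: w) (l :: w').

Ltac run_exec :=
  repeat match goal with
         | H : exec (_ :: _) _ _ _ _ |- _ => inversion H; subst; clear H
         end;
  repeat constructor; assumption.

Lemma step_exec {X : Type} w w' (i s1 s2 q : list X) :
  step w w' -> exec w i s1 s2 q -> exec w' i s1 s2 q.
Proof.
  intros H; revert i s1 s2 q; induction H; intros i s1 s2 q He;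
    try solve [run_exec].
  inversion He; subst; constructor; auto.
Qed.

(** The number of pairs made of an [A] or [B] and a later [C]; it is the termination measure for
    [step]. *)
Fixpoint inversions (w : list letter) : nat :=
  match w with
  | [] => 0
  | C :: w' => inversions w'
  | _ :: w' => count C w' + inversions w'
  end.

(** Each rule leaves fewer letters before its [C]. The preserved number of [C] carries the decrease
    through [step_cons]. *)
Lemma step_inversions w w' :
  step w w' -> count C w' = count C w /\ inversions w' < inversions w.
Proof. induction 1 as [w|w|w|[] w w' _ IH]; simpl; lia. Qed.

Definition redex (w : list letter) : bool :=
  match w with
  | A :: C :: _ | B :: A :: B :: C :: _ | A :: B :: B :: C :: _ => true
  | _ => false
  end.

Fixpoint reduced (w : list letter) : bool :=
  match w with
  | [] => true
  | _ :: w' => negb (redex w) && reduced w'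
  end.

Lemma redex_step w : redex w = true -> exists w', step w w'.
Proof.
  destruct w as [|[] [|[] [|[] [|[] w]]]]; simpl; intros H; try discriminate;
    eexists; constructor.
Qed.

Lemma not_reduced_step w : reduced w = false -> exists w', step w w'.
Proof.
  induction w as [|l w IH]; [discriminate|].
  change (reduced (l :: w)) with (negb (redex (l :: w)) && reduced w)%bool.
  destruct (redex (l :: w)) eqn:E; [intros _; now apply redex_step|].
  intros H; destruct (IH H) as [w' Hw]; exists (l :: w'); now constructor.
Qed.

Lemma exec_reduced {X : Type} w (i s1 s2 q : list X) :
  exec w i s1 s2 q -> exists w', reduced w' = true /\ exec w' i s1 s2 q.
Proof.
  remember (inversions w) as m eqn:Em; revert w Em.
  induction m as [m IH] using lt_wf_ind; intros w -> He.
  destruct (reduced w) eqn:E; [now exists w|].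
  destruct (not_reduced_step w E) as [w' Hs].
  destruct (step_inversions _ _ Hs) as [_ Hlt].
  exact (IH _ Hlt w' eq_refl (step_exec _ _ _ _ _ _ Hs He)).
Qed.

(** * Counting reduced words *)

Fixpoint reduced_words (m : nat) : list (list letter) :=
  match m with
  | 0 => [[]]
  | S m' =>
      flat_map (fun w => filter (fun u => negb (redex u))
                           [A :: w; B :: w; C :: w])
        (reduced_words m')
  end.

Lemma in_reduced_words w :
  reduced w = true -> In w (reduced_words (length w)).
Proof.
  induction w as [|l w IH]; [now left|].
  change (reduced (l :: w)) with (negb (redex (l :: w)) && reduced w)%bool.
  intros [Hr Hw]%andb_prop.
  apply in_flat_map; exists w; split; [auto|].
  apply filter_In; split; [|exact Hr].
  destruct l; simpl; auto.
Qed.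

(* The weights are [14] times [1/2, 2/7, 1/2]; the product of these three is
   [1/14].  [potential] is a superharmonic vector of the weighted transfer matrix
   that prepends a letter to a reduced word: see [potential_prepend]. *)
Definition letter_weight (l : letter) : nat :=
  match l with A => 7 | B => 4 | C => 7 end.

Fixpoint weight (w : list letter) : nat :=
  match w with
  | [] => 1
  | l :: w' => letter_weight l * weight w'
  end.

Definition potential (w : list letter) : nat :=
  match w with
  | C :: _ => 6
  | B :: C :: _ => 10
  | A :: B :: C :: _ => 10
  | B :: B :: C :: _ => 7
  | _ => 14
  end.

Definition mass (ws : list (list letter)) : nat :=
  list_sum (map (fun w => weight w * potential w) ws).

Lemma potential_prepend w :
  mass (filter (fun u => negb (redex u)) [A :: w; B :: w; C :: w])
  <= 14 * (weight w * potential w).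
Proof.
  unfold mass.
  (* The prepended letter and the first three letters of [w] decide every [redex] and [potential]
     here. *)
  destruct w as [|[] [|[] [|[] w]]]; simpl; lia.
Qed.

(** The empty word has mass 14, and by [potential_prepend] each further letter multiplies the total
    mass by at most 14. *)
Lemma mass_reduced_words m : mass (reduced_words m) <= 14 ^ m * 14.
Proof.
  assert (prepend : forall ws,
    mass (flat_map (fun w => filter (fun u => negb (redex u))
                               [A :: w; B :: w; C :: w]) ws) <= 14 * mass ws).
  { induction ws as [|w ws IH]; [apply le_n|].
    pose proof (potential_prepend w) as Hw.
    cbn [flat_map]; unfold mass in *.
    rewrite map_app, list_sum_app; cbn [map list_sum fold_right].
    fold (list_sum (map (fun w => weight w * potential w) ws)); lia. }
  induction m as [|m IH]; [apply le_n|].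
  cbn [reduced_words]; specialize (prepend (reduced_words m)).
  rewrite Nat.pow_succ_r'; lia.
Qed.

Lemma potential_ge w : 6 <= potential w.
Proof. destruct w as [|[] [|[] [|[] w]]]; simpl; lia. Qed.

Lemma weight_count w :
  weight w = 7 ^ count A w * 4 ^ count B w * 7 ^ count C w.
Proof.
  induction w as [|[] w IH]; [reflexivity|..]; cbn [weight]; rewrite IH; simpl;
    ring.
Qed.

Definition balanced (n : nat) (w : list letter) : bool :=
  (count A w =? n) && (count B w =? n) && (count C w =? n).

Definition balanced_words (n : nat) : list (list letter) :=
  filter (balanced n) (reduced_words (3 * n)).

(** A balanced word has weight [(7 * 4 * 7) ^ n = 196 ^ n] and potential at least 6, while the total
    mass is at most [14 ^ (3 * n) * 14]. Since [14 ^ 3 = 196 * 14], dividing leaves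
    [14 ^ n * 14]. *)
Lemma length_balanced_words n : length (balanced_words n) <= 14 ^ S n.
Proof.
  assert (H : forall ws,
    length (filter (balanced n) ws) * (196 ^ n * 6) <= mass ws).
  { induction ws as [|w ws IH]; [apply le_n|].
    unfold mass in *; cbn [filter map list_sum fold_right].
    fold (list_sum (map (fun w => weight w * potential w) ws)).
    destruct (balanced n w) eqn:E; [|lia].
    apply andb_prop in E as [[EA EB]%andb_prop EC].
    apply Nat.eqb_eq in EA, EB, EC.
    assert (Hw : weight w = 196 ^ n).
    { rewrite weight_count, EA, EB, EC, <- !Nat.pow_mul_l; reflexivity. }
    pose proof (potential_ge w) as Hp; rewrite Hw; cbn [length].
    pose proof (Nat.mul_le_mono_l _ _ (196 ^ n) Hp); lia. }
  specialize (H (reduced_words (3 * n))).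
  pose proof (mass_reduced_words (3 * n)) as Hm.
  assert (E : 14 ^ (3 * n) = 196 ^ n * 14 ^ n).
  { rewrite Nat.pow_mul_r, <- Nat.pow_mul_l; reflexivity. }
  rewrite E in Hm; fold (balanced_words n) in H.
  rewrite Nat.pow_succ_r'.
  assert (H0 : 196 ^ n <> 0) by (apply Nat.pow_nonzero; lia).
  apply (Nat.mul_le_mono_pos_l _ _ (196 ^ n)); lia.
Qed.

Lemma exec_balanced_words {X : Type} w (i q : list X) :
  exec w i [] [] q ->
  exists w', In w' (balanced_words (length i)) /\ exec w' i [] [] q.
Proof.
  intros (w' & Hr & He)%exec_reduced; exists w'; split; [|exact He].
  destruct (exec_count _ _ _ _ _ He) as (EA & EB & EC & _); simpl in EB, EC.
  apply filter_In; split.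
  - replace (3 * length i) with (length w') by (rewrite length_count; lia).
    now apply in_reduced_words.
  - unfold balanced; rewrite EA, EB, EC, !Nat.add_0_r, Nat.eqb_refl; reflexivity.
Qed.

(** * Cutting a series of stacks into pairs *)

(** One word per pair of stacks; each pair finishes before the next one starts, its whole output
    serving as the next input. *)
Inductive pipeline {X : Type} : list (list letter) -> list X -> list X -> Prop :=
| pipeline_nil i : pipeline [] i i
| pipeline_cons w ws i q o :
    exec w i [] [] q -> pipeline ws q o -> pipeline (w :: ws) i o.

Lemma pipeline_functional {X : Type} ws (i o o' : list X) :
  pipeline ws i o -> pipeline ws i o' -> o = o'.
Proof.
  intros H; revert o'; induction H as [|w ws i q o He _ IH]; intros o' H';
    inversion H'; subst; [reflexivity|].
  apply IH; replace q with q0; [assumption|].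
  eapply exec_functional; eassumption.
Qed.

Lemma run_no_stack ms i o o' :
  run 0 ms (Config i [] o) = Some (Config [] [] o') -> o' = o ++ i.
Proof.
  revert i o; induction ms as [|m ms IH]; intros i o H.
  - injection H as -> ->; now rewrite app_nil_r.
  - destruct m as [|[|m]]; [discriminate| |].
    + destruct i as [|x i]; [discriminate|].
      apply IH in H; rewrite H, <- app_assoc; reflexivity.
    + cbn in H; discriminate.
Qed.

(* The second stack of the pair is only passed through. *)
Lemma run_one_stack ms i s o o' :
  run 1 ms (Config i [s] o) = Some (Config [] [[]] o') ->
  exists w q, exec w i s [] q /\ o' = o ++ q.
Proof.
  revert i s o; induction ms as [|m ms IH]; intros i s o H.
  - injection H as -> -> ->; exists [], []; split; [constructor|].
    now rewrite app_nil_r.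
  - destruct m as [|[|[|m]]]; [discriminate| | |cbn in H; discriminate].
    + destruct i as [|x i]; [discriminate|].
      destruct (IH _ _ _ H) as (w & q & He & ->).
      exists (A :: w), q; split; [now constructor|reflexivity].
    + destruct s as [|x s]; [discriminate|].
      destruct (IH _ _ _ H) as (w & q & He & ->).
      exists (B :: C :: w), (x :: q); split; [now repeat constructor|].
      now rewrite <- app_assoc.
Qed.

(** Moves numbered four or more touch neither the input nor the first two stacks. They become moves
    of the remaining [k] stacks, renumbered by two, whatever queue [q] is waiting there. *)
Lemma move_skip_two k m i s1 s2 st o c :
  move (S (S k)) (S (S (S (S m)))) (Config i (s1 :: s2 :: st) o) = Some c ->
  exists st1 o1,
    c = Config i (s1 :: s2 :: st1) o1 /\
    forall q, move k (S (S m)) (Config q st o) = Some (Config q st1 o1).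
Proof.
  unfold move; cbn [Nat.eqb Nat.leb Nat.sub nth replace_nth cin cstacks cout andb
                    Nat.add].
  rewrite !Nat.sub_0_r.
  destruct k as [|k]; cbn [Nat.eqb Nat.leb Nat.sub Nat.add];
    [destruct m; discriminate|].
  rewrite !Nat.sub_0_r, !Bool.andb_true_r.
  cbn [nth replace_nth].
  destruct (match k with 0 => false | S m' => m <=? m' end).
  - destruct (nth m st []) as [|x r]; intros [= <-].
    now exists (replace_nth (replace_nth st m r) (S m) (x :: nth (S m) st [])), o.
  - destruct (match k + 1 with 0 => false | S m' => m =? m' end); [|discriminate].
    destruct (nth k st []) as [|x r]; intros [= <-].
    now exists (replace_nth st k r), (o ++ [x]).
Qed.

(** The first pair never depends on the later stacks, so it may run to the end first. Here [q] is
    everything it has yet to emit, all of it already queued as input for the later stacks. *)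
Lemma run_split_two k ms i s1 s2 st st' o o' :
  run (S (S k)) ms (Config i (s1 :: s2 :: st) o)
    = Some (Config [] ([] :: [] :: st') o') ->
  exists w q ms',
    exec w i s1 s2 q /\ run k ms' (Config q st o) = Some (Config [] st' o').
Proof.
  revert i s1 s2 st o; induction ms as [|m ms IH]; intros i s1 s2 st o H.
  { injection H as -> -> -> -> ->.
    exists [], [], []; split; [constructor|reflexivity]. }
  destruct m as [|[|[|[|m]]]]; [discriminate| | | |].
  - destruct i as [|x i]; [discriminate|].
    destruct (IH _ _ _ _ _ H) as (w & q & ms' & He & Hr).
    exists (A :: w), q, ms'; split; [now constructor|exact Hr].
  - destruct s1 as [|x s1]; [discriminate|].
    destruct (IH _ _ _ _ _ H) as (w & q & ms' & He & Hr).
    exists (B :: w), q, ms'; split; [now constructor|exact Hr].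
  (* Move 3 is the letter [C] of the pair and move 1 of the rest; for [k = 0] the latter passes
     straight from input to output. *)
  - destruct s2 as [|x s2]; [destruct k; discriminate|].
    destruct k as [|k]; destruct (IH _ _ _ _ _ H) as (w & q & ms' & He & Hr);
      exists (C :: w), (x :: q), (1 :: ms'); (split; [now constructor|exact Hr]).
  - cbn [run] in H.
    destruct (move (S (S k)) (S (S (S (S m)))) (Config i (s1 :: s2 :: st) o))
      as [c|] eqn:E; [|discriminate].
    destruct (move_skip_two _ _ _ _ _ _ _ _ E) as (st1 & o1 & -> & Hm).
    destruct (IH _ _ _ _ _ H) as (w & q & ms' & He & Hr).
    exists w, q, (S (S m) :: ms'); split; [exact He|].
    cbn [run]; now rewrite Hm.
Qed.

(** Strip two stacks at a time; a last odd stack takes a word of its own, hence [Nat.div2 (S k)],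
    which is [k / 2] rounded up. *)
Lemma run_pipeline k i ms pi :
  run k ms (Config i (repeat [] k) []) = Some (Config [] (repeat [] k) pi) ->
  exists ws, length ws = Nat.div2 (S k) /\ pipeline ws i pi.
Proof.
  revert i ms; induction k as [k IH] using lt_wf_ind; intros i ms H.
  destruct k as [|[|k]].
  - exists []; split; [reflexivity|].
    apply run_no_stack in H as ->; constructor.
  - destruct (run_one_stack _ _ _ _ _ H) as (w & q & He & ->).
    exists [w]; split; [reflexivity|].
    econstructor; [exact He|constructor].
  - destruct (run_split_two _ _ _ _ _ _ _ _ _ H) as (w & q & ms' & He & Hr).
    destruct (IH k ltac:(lia) _ _ Hr) as (ws & Hl & Hp).
    exists (w :: ws); split; [simpl; now rewrite Hl|].
    econstructor; eassumption.
Qed.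

(** * Counting permutations *)

Fixpoint tuples {X : Type} (j : nat) (l : list X) : list (list X) :=
  match j with
  | 0 => [[]]
  | S j' => flat_map (fun x => map (cons x) (tuples j' l)) l
  end.

Lemma length_tuples {X : Type} j (l : list X) :
  length (tuples j l) = length l ^ j.
Proof.
  induction j as [|j IH]; [reflexivity|]; cbn [tuples].
  rewrite (flat_map_constant_length (c := length l ^ j)); [now rewrite Nat.pow_succ_r'|].
  intros x _; now rewrite length_map.
Qed.

(** Replacing a word by a reduced one keeps its output, and lengths are preserved from pair to pair,
    so one list of balanced words serves at all of them. *)
Lemma pipeline_tuples {X : Type} ws (i o : list X) :
  pipeline ws i o ->
  exists ws', In ws' (tuples (length ws) (balanced_words (length i))) /\
              pipeline ws' i o.
Proof.
  induction 1 as [i|w ws i q o He _ IH]; [exists []; split; [now left|constructor]|].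
  destruct IH as (ws' & Hin & Hp).
  destruct (exec_count _ _ _ _ _ He) as (_ & _ & _ & Hq); simpl in Hq.
  rewrite !Nat.add_0_r in Hq; rewrite Hq in Hin.
  destruct (exec_balanced_words _ _ _ He) as (w' & Hw & He').
  exists (w' :: ws'); split; [|econstructor; eassumption].
  apply in_flat_map; exists w'; split; [exact Hw|].
  now apply in_map.
Qed.

Lemma exists_permutations {X : Type} n (l : list X) :
  NoDup l -> length l = n ->
  exists ps, NoDup ps /\ length ps = fact n /\
             forall p, In p ps -> Permutation p l.
Proof.
  revert l; induction n as [|n IH]; intros l Hnd Hl.
  { exists [[]]; repeat split; [repeat constructor; auto|].
    apply length_zero_iff_nil in Hl as ->.
    now intros p [<-|[]]. }
  (* Induct on the set [hs] of allowed heads; recording the head keeps the blocks for different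
     heads disjoint. *)
  enough (H : forall hs, NoDup hs -> incl hs l ->
    exists ps, NoDup ps /\ length ps = length hs * fact n /\
      forall p, In p ps ->
        Permutation p l /\ exists x p', In x hs /\ p = x :: p').
  { destruct (H l Hnd (incl_refl l)) as (ps & Hps & Hlen & Hin).
    exists ps; rewrite Hlen, Hl; repeat split; [exact Hps|].
    intros p Hp; now apply Hin. }
  induction hs as [|x hs IHhs]; intros Hhs Hincl.
  { exists []; repeat split; [constructor|..]; easy. }
  apply NoDup_cons_iff in Hhs as [Hx Hhs].
  destruct (IHhs Hhs (fun y Hy => Hincl y (or_intror Hy)))
    as (ps & Hps & Hlen & Hin).
  destruct (in_split x l (Hincl x (or_introl eq_refl))) as (l1 & l2 & El).
  rewrite El in Hnd, Hl; apply NoDup_remove_1 in Hnd.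
  rewrite length_app in Hl; simpl in Hl.
  destruct (IH (l1 ++ l2) Hnd ltac:(rewrite length_app; lia))
    as (qs & Hqs & Hqlen & Hqin).
  exists (map (cons x) qs ++ ps); repeat split.
  - apply NoDup_app; [|exact Hps|].
    + apply FinFun.Injective_map_NoDup; [|exact Hqs].
      intros a b Hab; now injection Hab.
    + intros p (q & <- & _)%in_map_iff Hp.
      destruct (Hin _ Hp) as (_ & y & p' & Hy & Ey).
      injection Ey as -> _; contradiction.
  - rewrite length_app, length_map, Hqlen, Hlen; simpl; lia.
  - apply in_app_or in H as [(q & <- & Hq)%in_map_iff|Hp].
    + rewrite El; apply Permutation_cons_app, Hqin, Hq.
    + now apply Hin.
  - apply in_app_or in H as [(q & <- & Hq)%in_map_iff|Hp].
    + exists x, q; split; [now left|reflexivity].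
    + destruct (Hin _ Hp) as (_ & y & p' & Hy & Ey).
      exists y, p'; split; [now right|exact Ey].
Qed.

(** Pigeonhole for a partial function given as a relation: a [t] related to [p] is related to no
    other element, so it can be removed from [ts] along with [p]. *)
Lemma NoDup_length_le_functional {X Y : Type} (rel : Y -> X -> Prop)
    (ps : list X) (ts : list Y) :
  (forall t p p', rel t p -> rel t p' -> p = p') ->
  NoDup ps -> (forall p, In p ps -> exists t, In t ts /\ rel t p) ->
  length ps <= length ts.
Proof.
  intros Hfun; revert ts; induction ps as [|p ps IH]; intros ts Hnd Hex.
  { apply Nat.le_0_l. }
  apply NoDup_cons_iff in Hnd as [Hp Hnd].
  destruct (Hex p (or_introl eq_refl)) as (t & Ht & Hrel).
  destruct (in_split t ts Ht) as (t1 & t2 & ->).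
  rewrite length_app; simpl; rewrite Nat.add_succ_r, <- length_app.
  apply le_n_S, IH; [exact Hnd|].
  intros p' Hp'; destruct (Hex p' (or_intror Hp')) as (t' & Ht' & Hrel').
  exists t'; split; [|exact Hrel'].
  apply in_app_or in Ht' as [H|[<-|H]]; apply in_or_app; auto.
  elim Hp; now rewrite (Hfun _ _ _ Hrel Hrel').
Qed.

Lemma all_generated_fact_le k n :
  all_generated k n -> fact n <= 14 ^ (S n * Nat.div2 (S k)).
Proof.
  intros Hall.
  destruct (exists_permutations n (seq 1 n) (seq_NoDup n 1) (length_seq n 1))
    as (ps & Hps & <- & Hperm).
  transitivity (length (tuples (Nat.div2 (S k)) (balanced_words n))).
  - apply (NoDup_length_le_functional (fun ws p => pipeline ws (seq 1 n) p));
      [intros t p p'; apply pipeline_functional|exact Hps|].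
    intros p Hp; destruct (Hall p (Hperm p Hp)) as (ms & Hrun).
    destruct (run_pipeline _ _ _ _ Hrun) as (ws & <- & Hpi).
    destruct (pipeline_tuples _ _ _ Hpi) as (ws' & Hin & Hpi').
    rewrite length_seq in Hin; now exists ws'.
  - rewrite length_tuples, Nat.pow_mul_r.
    apply Nat.pow_le_mono_l, length_balanced_words.
Qed.

(** * The asymptotic bound *)

Local Open Scope R_scope.

Lemma ln_le x y : 0 < x -> x <= y -> ln x <= ln y.
Proof. intros Hx [H| ->]; [left; now apply ln_increasing|right; reflexivity]. Qed.

(** Weak Stirling bound; the induction step reduces to [n * ln (1 + 1/n) <= 1]. *)
Lemma ln_fact_ge n : (1 <= n)%nat -> INR n * ln (INR n) - INR n <= ln (INR (fact n)).
Proof.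
  induction 1 as [|n Hn IH]; [simpl; rewrite ln_1; lra|].
  assert (Hn0 : 0 < INR n) by (apply lt_0_INR; lia).
  rewrite fact_simpl, mult_INR, ln_mult;
    [|apply lt_0_INR; lia|apply INR_fact_lt_0].
  rewrite S_INR.
  assert (Hi : 0 < / INR n) by now apply Rinv_0_lt_compat.
  assert (Hln : ln (1 + / INR n) <= / INR n).
  { rewrite <- (ln_exp (/ INR n)) at 2.
    apply ln_le; [lra|apply exp_ineq1_le]. }
  replace (INR n + 1) with (INR n * (1 + / INR n)) by (field; lra).
  rewrite ln_mult by lra.
  replace (INR n * (1 + / INR n)) with (INR n + 1) by (field; lra).
  apply (Rmult_le_compat_l (INR n)) in Hln; [|lra].
  rewrite Rinv_r in Hln by lra.
  lra.
Qed.

Theorem theorem2 :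
  exists C : R, forall n k : nat, (1 <= n)%nat -> is_k_n n k ->
    INR k >= 2 * log2R (INR n) / log2R (14864 / 1000) - C.
Proof.
  set (L := ln (14864 / 1000)).
  assert (H14 : 0 < ln 14) by (rewrite <- ln_1; apply ln_increasing; lra).
  assert (HL : ln 14 < L) by (apply ln_increasing; lra).
  assert (H2 : 0 < ln 2) by (rewrite <- ln_1; apply ln_increasing; lra).
  (* Beyond this threshold [(n + 1) * ln 14 <= n * L]: the gap between 14 and 14.864 absorbs the
     extra 1 in the exponent. *)
  set (M := ln 14 / (L - ln 14)).
  assert (HM : 0 < M) by (apply Rdiv_lt_0_compat; lra).
  (* The 2 pays for the linear term of the Stirling bound, [2 * ln (M + 1)] for all [n] up to [M],
     and the final 1 for rounding [k / 2] up. *)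
  exists ((2 + 2 * ln (M + 1)) / L + 1); intros n k Hn [Hall _].
  assert (Hn1 : 1 <= INR n) by (now apply (le_INR 1)).
  replace (2 * log2R (INR n) / log2R (14864 / 1000)) with (2 * ln (INR n) / L)
    by (unfold log2R; fold L; field; lra).
  assert (HlnM : 0 <= ln (M + 1)) by (rewrite <- ln_1; apply ln_le; lra).
  enough (H : 2 * ln (INR n) <= (INR k + 1) * L + 2 + 2 * ln (M + 1)).
  { apply Rle_ge, (Rmult_le_reg_r L); [lra|].
    replace ((2 * ln (INR n) / L - ((2 + 2 * ln (M + 1)) / L + 1)) * L)
      with (2 * ln (INR n) - 2 - 2 * ln (M + 1) - L) by (field; lra).
    lra. }
  pose proof (pos_INR k) as Hk.
  destruct (Rle_lt_dec (INR n) M) as [HnM|HnM].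
  { assert (ln (INR n) <= ln (M + 1)) by (apply ln_le; lra).
    nra. }
  assert (HnL : (INR n + 1) * ln 14 <= INR n * L).
  { apply (Rmult_lt_compat_r (L - ln 14)) in HnM; [|lra].
    unfold M in HnM; replace (ln 14 / (L - ln 14) * (L - ln 14)) with (ln 14) in HnM
      by (field; lra); lra. }
  set (j := Nat.div2 (S k)).
  assert (Hj : 2 * INR j <= INR k + 1).
  { rewrite <- S_INR; change 2 with (INR 2); rewrite <- mult_INR; apply le_INR.
    pose proof (Nat.div2_odd (S k)); fold j in H; lia. }
  pose proof (ln_fact_ge n Hn) as Hf.
  assert (Hle : ln (INR (fact n)) <= INR j * ((INR n + 1) * ln 14)).
  { transitivity (ln (INR (14 ^ (S n * j)))).
    - apply ln_le; [apply INR_fact_lt_0|].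
      now apply le_INR, all_generated_fact_le.
    - rewrite pow_INR, ln_pow by (simpl; lra).
      rewrite mult_INR, S_INR; replace (INR 14) with 14 by (simpl; lra).
      apply Req_le; ring. }
  (* Chain the bounds on [ln (fact n)] with [HnL] and divide by [n]. *)
  assert (Hmain : ln (INR n) - 1 <= INR j * L).
  { apply (Rmult_le_reg_l (INR n)); [lra|].
    pose proof (Rmult_le_compat_l (INR j) _ _ (pos_INR j) HnL); lra. }
  nra.
Qed.
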